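(* Let $\mathbf{x}\in\{0,1\}^{\mathbb{N}}$ be a binary infinite word that is aperiodic, uniformly recurrent, and not Sturmian. Then the abelian closure $\mathcal{A}(\mathbf{x})$ contains infinitely many minimal subshifts.
   Context: Infinite words are right-infinite sequences of letters over a finite alphabet $\Sigma$; a factor of a finite or infinite word is a finite block of consecutive letters. $\mathcal{L}(\mathbf{x})$ is the set of all factors of $\mathbf{x}$. Two finite words $u,v$ are abelian equivalent, $u\sim v$, if every letter occurs equally many times in $u$ and in $v$. The abelian closure of $\mathbf{x}\in\Sigma^{\mathbb{N}}$ is $\mathcal{A}(\mathbf{x})=\{\mathbf{y}\in\Sigma^{\mathbb{N}} : \text{for every } u\in\mathcal{L}(\mathbf{y}) \text{ there is } v\in\mathcal{L}(\mathbf{x}) \text{ with } u\sim v\}$. The word $\mathbf{x}$ is ultimately periodic if $\mathbf{x}=uv^{\omega}$ for finite words $u,v$ with $v$ non-empty ($v^\omega$ being the infinite repetition of $v$), and aperiodic otherwise. It is uniformly recurrent if for every factor $u$ of $\mathbf{x}$ there is $N$ such that every factor of $\mathbf{x}$ of length $N$ contains $u$. It is Sturmian if it has exactly $n+1$ distinct factors of length $n$ for every $n\in\mathbb{N}$. A subshift is a non-empty closed set $X\subseteq\Sigma^{\mathbb{N}}$ (product topology of the discrete topology on $\Sigma$) with $\sigma(X)\subseteq X$, where $\sigma(a_0a_1a_2\cdots)=a_1a_2\cdots$. A subshift is minimal if it does not properly contain any subshift. ''$\mathcal{A}(\mathbf{x})$ contains infinitely many minimal subshifts'' means that there are infinitely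 many distinct minimal subshifts $X$ with $X\subseteq\mathcal{A}(\mathbf{x})$. *)

(* Defs.v *)
From mathcomp Require Import all_boot all_classical.
From mathcomp Require Import topology function_spaces.

Set Implicit Arguments.
Unset Strict Implicit.
Unset Printing Implicit Defensive.

Local Open Scope classical_set_scope.
Local Open Scope card_scope.

Definition infword (S : finType) : Type := nat -> S.

Definition factor_at (S : finType) (x : infword S) (i n : nat) : seq S :=
  mkseq (fun k => x (i + k)) n.

Definition language (S : finType) (x : infword S) : set (seq S) :=
  [set u | exists i n, u = factor_at x i n].

Definition abelian_equiv (S : finType) (u v : seq S) : Prop :=
  forall a : S, count_mem a u = count_mem a v.

Definition abelian_closure (S : finType) (x : infword S) : set (infword S) :=
  [set y | forall u, language y u ->
             exists2 v, language x v & abelian_equiv u v].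

Definition prepend (S : finType) (u : seq S) (y : infword S) : infword S :=
  fun n => if n < size u then nth (y 0) u n else y (n - size u).

(* v^omega for the non-empty word v = a :: s. *)
Definition omega_power (S : finType) (a : S) (s : seq S) : infword S :=
  fun n => nth a (a :: s) (n %% size (a :: s)).

Definition ultimately_periodic (S : finType) (x : infword S) : Prop :=
  exists (u : seq S) (a : S) (s : seq S), x = prepend u (omega_power a s).

Definition aperiodic (S : finType) (x : infword S) : Prop :=
  ~ ultimately_periodic x.

Definition uniformly_recurrent (S : finType) (x : infword S) : Prop :=
  forall u, language x u ->
    exists N, forall w, language x w -> size w = N -> infix u w.

Definition sturmian (S : finType) (x : infword S) : Prop :=
  forall n, [set u | language x u /\ size u = n] #= `I_n.+1.

Definition shift (S : finType) (x : infword S) : infword S :=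
  fun n => x n.+1.

(* The topology is named explicitly in the type of X: the product over nat of
   the discrete topology on S. *)
Definition subshift (S : finType) (X : set (infword S)) : Prop :=
  [/\ X !=set0,
      closed (X : set {ptws nat -> discrete_topology S}) &
      @shift S @` X `<=` X].

Definition minimal_subshift (S : finType) (X : set (infword S)) : Prop :=
  subshift X /\ forall Y : set (infword S), subshift Y -> ~ (Y `<` X).

(* Main.v *)
(** Write S_n for the number of ones among the first n letters of x. A word y
    lies in the abelian closure of x iff the differences of its prefix sums obey
    the same bounds lo(j - i) <= S_j - S_i as those of x, and a uniformly
    recurrent y spans a minimal subshift determined by its language. It thus
    suffices to exhibit uniformly recurrent words obeying these bounds, with
    infinitely many different languages.

    If some rational line of slope p/q obeys the bounds, it obeys them strictly,
    because x is aperiodic and uniformly recurrent. There is then room to lower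
    the staircase floor(np/q) by one at the multiples of kq, and distinct k give
    periodic words with distinct languages.

    Otherwise x has an irrational slope alpha, and the discrepancy
    D_n = S_n - alpha n grows sublinearly. Raise S by one wherever D_n is the
    minimum of D over the window [n - L, n + L]. The new word y_L still obeys the
    bounds, and is a sliding block image of x, hence uniformly recurrent. As L
    grows the raised points get sparse, so that every factor of x occurs in y_L
    for large L. However y_L misses some factor of x: if N is a local maximum,
    over a window of radius L, of the excess alpha N - lo(N), then both ends of a
    pair realising lo(N) are local extrema of D, so that raising destroys the
    pair, and no new such pair is created as D oscillates by more than one (x is
    not balanced, since not Sturmian). Hence infinitely many of the languages of
    the y_L are distinct. *)

Require Import Defs.
From mathcomp Require Import all_boot all_order all_algebra all_classical.
From mathcomp Require Import topology function_spaces.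
From mathcomp Require Import reals Rstruct.
From mathcomp Require Import zify ring lra.
Import Order.TTheory GRing.Theory Num.Theory.

Set Implicit Arguments.
Unset Strict Implicit.
Unset Printing Implicit Defensive.

Local Open Scope classical_set_scope.

(** * Languages and minimal subshifts *)

Section Words.
Variable S : finType.
Implicit Types x y z : infword S.

Lemma size_factor_at x i n : size (factor_at x i n) = n.
Proof. exact: size_mkseq. Qed.

Lemma language_factor_at x i n : language x (factor_at x i n).
Proof. by exists i, n. Qed.

Lemma eq_factor_at x y i j n :
  factor_at x i n = factor_at y j n <-> forall t, t < n -> x (i + t) = y (j + t).
Proof.
split=> [e t tn|e].
  by have := congr1 (fun s => nth (x 0) s t) e; rewrite /= !nth_mkseq.
apply: (@eq_from_nth _ (x 0)); rewrite !size_factor_at // => t tn.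
by rewrite !nth_mkseq // e.
Qed.

Lemma infix_factor_at x i a b n :
  a + b <= n -> infix (factor_at x (i + a) b) (factor_at x i n).
Proof.
move=> abn; apply/infixP; exists (factor_at x i a), (factor_at x (i + a + b) (n - a - b)).
apply: (@eq_from_nth _ (x 0)); rewrite ?size_cat ?size_factor_at; first by lia.
move=> t tn; rewrite nth_cat size_factor_at nth_mkseq //.
case: ltnP => ta; first by rewrite nth_mkseq.
rewrite nth_cat size_factor_at; case: ltnP => tb; rewrite nth_mkseq; try lia; congr x; lia.
Qed.

Lemma infix_factor_atP x u i n : infix u (factor_at x i n) ->
  exists2 a, a + size u <= n & u = factor_at x (i + a) (size u).
Proof.
case/infixP => s [s' e].
have sz : n = size s + (size u + size s').
  by rewrite -[n](size_factor_at x i) e !size_cat.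
exists (size s); first by lia.
apply: (@eq_from_nth _ (x 0)); rewrite ?size_factor_at // => t tn.
have := congr1 (fun v => nth (x 0) v (size s + t)) e.
rewrite nth_mkseq; last by rewrite sz ltn_add2l ltn_addr.
rewrite nth_mkseq // nth_cat addnA => ->.
by rewrite ltnNge leq_addr addKn nth_cat tn.
Qed.

Lemma uniformly_recurrentP x : uniformly_recurrent x <->
  forall i n, exists K, forall j, exists2 a, a <= K &
    factor_at x (j + a) n = factor_at x i n.
Proof.
split=> [ux i n|ux u [i [n ->]]].
  have [K HK] := ux _ (language_factor_at x i n); exists K => j.
  have := HK _ (language_factor_at x j K) (size_factor_at _ _ _).
  move/infix_factor_atP => [a]; rewrite !size_factor_at => aK e.
  by exists a; [lia|].
have [K HK] := ux i n; exists (K + n) => w [j [m e]].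
rewrite e size_factor_at => ->.
have [a aK <-] := HK j; apply: infix_factor_at; lia.
Qed.

Lemma aperiodicP x i0 p : aperiodic x -> 0 < p ->
  exists2 i, i0 <= i & x (i + p) <> x i.
Proof.
move=> ax p0; apply: contrapT => nx; apply: ax.
have per i : i0 <= i -> x (i + p) = x i.
  by move=> ii; apply: contrapT => ne; apply: nx; exists i.
case: p p0 {nx} per => // p _ per.
have perk k i : i0 <= i -> x (i + k * p.+1) = x i.
  move=> ii; elim: k => [|k IH]; first by rewrite addn0.
  by rewrite mulSn addnCA addnA addnC -IH -[RHS]per; [congr x|]; lia.
exists (factor_at x 0 i0), (x i0), (factor_at x i0.+1 p); apply/funext => n.
rewrite /prepend /omega_power /= !size_factor_at.
case: ltnP => ni; first by rewrite nth_mkseq.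
have rp := ltn_pmod (n - i0) (ltn0Sn p).
have {1}-> : n = i0 + (n - i0) %% p.+1 + (n - i0) %/ p.+1 * p.+1.
  by have := divn_eq (n - i0) p.+1; lia.
rewrite perk ?leq_addr //.
case: (_ %% _) rp => [|r] rp /=; first by rewrite addn0.
by rewrite nth_mkseq //= addSnnS.
Qed.

(** This is the orbit closure of [y] under the shift: [z] belongs to it as soon as all its prefixes
    are factors of [y]. *)
Definition sublanguage_space y : set (infword S) :=
  [set z | language z `<=` language y].

Lemma closed_agree (Y : set (infword S)) z :
    closed (Y : set {ptws nat -> discrete_topology S}) ->
    (forall n, exists2 w, Y w & forall t, t < n -> w t = z t) -> Y z.
Proof.
move=> cY H.
have /choice [w wP] n : exists w, Y w /\ forall t, t < n -> w t = z t.
  by have [w] := H n; exists w.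
apply: (@closed_cvg nat {ptws nat -> discrete_topology S} \oo _ w) => //.
  by apply: nearW => n; exact: (wP n).1.
apply/(@pointwise_cvgP nat (discrete_topology S)) => t A /= At.
have {}At : A (z t) by exact: nbhs_singleton At.
by exists t.+1 => // n /= tn; rewrite (wP n).2.
Qed.

Lemma closed_sublanguage_space y :
  closed (sublanguage_space y : set {ptws nat -> discrete_topology S}).
Proof.
move=> z /= cz u [i [n ->]].
have FF : Filter (nbhs (z : {ptws nat -> discrete_topology S})).
  exact: nbhs_filter.
have nU m : nbhs (z : {ptws nat -> discrete_topology S})
    [set w | forall t, t < m -> w t = z t].
  elim: m => [|m IH]; first by apply: filterS filterT.
  have nm : nbhs (z : {ptws nat -> discrete_topology S}) [set w | w m = z m].
    apply: (@proj_continuous nat (fun=> discrete_topology S) m z [set z m]).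
    by [].
  apply: filterS (filterI nm IH) => w [wm wt] t.
  by rewrite ltnS leq_eqVlt => /predU1P[->|]; [|exact: wt].
have [w [wy Uw]] := cz _ (nU (i + n)).
apply: wy; exists i, n; apply/eq_factor_at => t tn.
by rewrite Uw // ltn_add2l.
Qed.
End Words.

(** * Minimal subshifts spanned by uniformly recurrent words *)

Section MinimalSubshifts.
Variable S : finType.
Implicit Types x y z : infword S.

Lemma subshift_iter (Y : set (infword S)) w i :
  subshift Y -> Y w -> Y (fun n => w (i + n)).
Proof.
move=> [_ _ sY] Yw; elim: i => [|i IH] //.
by apply: sY; exists (fun n => w (i + n)) => //; apply/funext => n; rewrite /shift addnS.
Qed.

(** Let [w] lie in a smaller subshift [Y]. A prefix of [z] is a factor of [y], so it occurs in every
    long factor of [y], in particular in a prefix of [w]. Shifts of [w] thus approach [z], and [Y]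
    is closed. *)
Lemma minimal_sublanguage_space y :
  uniformly_recurrent y -> minimal_subshift (sublanguage_space y).
Proof.
move=> uy; split.
  split; [by exists y | exact: closed_sublanguage_space |].
  by move=> _ [z zy <-] u [i [n ->]]; apply: zy; exists i.+1, n.
move=> Y sY [Yy]; apply=> z zy.
have [[w Yw] cY _] := sY.
apply: closed_agree cY _ => n.
have [K HK] := uy _ (zy _ (language_factor_at z 0 n)).
have wK : language y (factor_at w 0 K) by apply: Yy Yw _ _; exact: language_factor_at.
have [a _] := infix_factor_atP (HK _ wK (size_factor_at _ _ _)).
rewrite size_factor_at => /eq_factor_at e.
by exists (fun k => w (a + k)); [exact: (subshift_iter a sY Yw) | move=> t /e ->].
Qed.

Lemma sublanguage_space_abelian_closure x y :
  abelian_closure x y -> sublanguage_space y `<=` abelian_closure x.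
Proof. by move=> xy z zy u /zy /xy. Qed.

(** If the range were finite, the thresholds of its values would have a maximum [m], and [g m] would
    have to differ from itself. *)
Lemma infinite_range_frequently_new (T : choiceType) (g : nat -> T) :
  (forall k, exists m, forall n, m <= n -> g n <> g k) -> infinite_set (range g).
Proof.
move=> H fing.
have /choice [h hP] t : exists m, forall n, m <= n -> g n <> t.
  have [[k ->]|nt] := pselect (exists k, t = g k); first exact: H.
  by exists 0 => n _ e; apply: nt; exists n.
have /finite_seqP [s hs] := finite_image h fing.
pose m := \max_(i <- s) i.
have : (h @` range g) (h (g m)) by exists (g m) => //; exists m.
rewrite hs /= => /(@leq_bigmax_seq _ s xpredT id _)/(_ isT) hm.
exact: (hP (g m) m).
Qed.

Lemma infinite_minimal_subshifts x (f : nat -> infword S) :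
    (forall k, uniformly_recurrent (f k)) -> (forall k, abelian_closure x (f k)) ->
    (forall k, exists m, forall n, m <= n -> language (f n) <> language (f k)) ->
  infinite_set [set X : set (infword S) |
                  minimal_subshift X /\ X `<=` abelian_closure x].
Proof.
move=> uf xf df; apply: (@sub_infinite_set _ (range (fun k => sublanguage_space (f k)))).
  move=> _ [k _ <-]; split; first exact: minimal_sublanguage_space.
  exact: sublanguage_space_abelian_closure.
apply: infinite_range_frequently_new => k; have [m mP] := df k.
exists m => n /mP lnk e; apply: lnk; apply/seteqP; split.
  by have : sublanguage_space (f n) (f n) by []; rewrite e.
by have : sublanguage_space (f k) (f k) by []; rewrite -e.
Qed.
End MinimalSubshifts.

(** * Prefix sums of binary words *)

Local Open Scope ring_scope.

Definition psum (x : infword bool) (n : nat) : int := (\sum_(i < n) x i)%N.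

Lemma psumS x n : psum x n.+1 = psum x n + (x n)%:Z.
Proof. by rewrite /psum big_ord_recr /= PoszD. Qed.

Lemma psum_leD x i n : psum x i <= psum x (i + n)%N <= psum x i + n%:Z.
Proof.
elim: n => [|n]; rewrite ?addn0 ?addr0 ?lexx // addnS psumS.
by case: (x _) => /=; lia.
Qed.

Lemma count_factor_at x i n :
  (count_mem true (factor_at x i n))%:Z = psum x (i + n)%N - psum x i.
Proof.
elim: n => [|n IH]; first by rewrite addn0 subrr.
rewrite /factor_at mkseqS -cats1 count_cat PoszD -/(factor_at x i n) IH addnS psumS /=.
by case: (x _) => /=; lia.
Qed.

Lemma eq_psum_factor_at x y i j n :
  (forall t, (t <= n)%N -> psum x (i + t)%N - psum x i = psum y (j + t)%N - psum y j) <->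
  factor_at x i n = factor_at y j n.
Proof.
split=> [e|/eq_factor_at e].
  apply/eq_factor_at => t tn; have := e _ tn; have := e _ (ltnW tn).
  by rewrite !addnS !psumS; case: (x _); case: (y _) => //=; lia.
elim=> [|t IH] tn; first by rewrite !addn0 !subrr.
by rewrite !addnS !psumS e //; have := IH (ltnW tn); lia.
Qed.

Lemma abelian_equiv_bool (u v : seq bool) :
  size u = size v -> count_mem true u = count_mem true v -> abelian_equiv u v.
Proof.
have cf w : count_mem false w = (size w - count_mem true w)%N.
  rewrite -(count_predC (pred1 true) w) addKn; apply: eq_count => b /=.
  by case: b.
by move=> su cu [] //; rewrite !cf su cu.
Qed.

Lemma int_ivt_le (f : nat -> int) w a n :
    (forall k, `|f k.+1 - f k| <= 1) -> f a <= w -> w <= f (a + n)%N ->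
  exists c, f c = w.
Proof.
move=> fS fa; elim: n => [|n IH] fb; first by exists a; rewrite addn0 in fb; lia.
have [/IH//|wn] := leP w (f (a + n)%N).
by exists (a + n.+1)%N; have := fS (a + n)%N; rewrite addnS in fb *; lia.
Qed.

Lemma int_ivt (f : nat -> int) w a b :
  (forall k, `|f k.+1 - f k| <= 1) -> f a <= w -> w <= f b -> exists c, f c = w.
Proof.
move=> fS fa fb; have [ab|/ltnW ba] := leqP a b.
  by apply: (@int_ivt_le f w a (b - a)%N); rewrite ?subnKC.
have [|||c] := @int_ivt_le (fun k => - f k) (- w) b (a - b)%N.
- by move=> k; have := fS k; lia.
- by lia.
- by rewrite subnKC //; lia.
- by move=> /oppr_inj; exists c.
Qed.

(* Negative arguments encode maximal weights: [lo n] is the least and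
   [- lo (- n)] the greatest number of ones in a factor of length [n]. *)
Definition weight_bound (x : infword bool) (lo : int -> int) : Prop :=
  (forall i j : nat, lo (j%:Z - i%:Z) <= psum x j - psum x i) /\
  (forall N, exists i j : nat, j%:Z - i%:Z = N /\ psum x j - psum x i = lo N).

Lemma weight_bound_exists x : exists lo, weight_bound x lo.
Proof.
have ex (N : int) : exists l,
    (forall i j : nat, j%:Z - i%:Z = N -> l <= psum x j - psum x i) /\
    exists i j : nat, j%:Z - i%:Z = N /\ psum x j - psum x i = l.
  (* Adding [|N|] makes the differences nonnegative, so that a least one exists. *)
  pose P k := `[< exists i j : nat, j%:Z - i%:Z = N /\ psum x j - psum x i + `|N| = k%:Z >].
  have ge0 (i j : nat) : j%:Z - i%:Z = N -> 0 <= psum x j - psum x i + `|N|.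
    move=> e; have [ij|/ltnW ji] := leqP i j.
      by have := psum_leD x i (j - i); rewrite subnKC //; lia.
    by have := psum_leD x j (i - j); rewrite subnKC //; lia.
  have exP : exists k, P k.
    have [i [j e]] : exists i j : nat, j%:Z - i%:Z = N.
      by exists `|N|%N, (`|(N + `|N|)%R|)%N; lia.
    exists (`|(psum x j - psum x i + `|N|)%R|)%N; apply/asboolP.
    by exists i, j; split=> //; have := ge0 _ _ e; lia.
  case: (ex_minnP exP) => k /asboolP [i [j [e1 e2]]] kmin.
  exists (k%:Z - `|N|); split; last by exists i, j; split=> //; lia.
  move=> i' j' e'; have := ge0 _ _ e'.
  case e: (psum x j' - psum x i' + `|N|) => [k'|//] _.
  have /kmin : P k' by apply/asboolP; exists i', j'.
  by move: e; lia.
have [lo loP] := choice ex; exists lo; split=> [i j|N]; last exact: (loP N).2.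
exact: (loP _).1.
Qed.

(** Sliding a window of length [n] by one letter changes its weight by at most one, so [x] has
    factors of every weight between the extremes [lo n] and [- lo (- n)]. *)
Lemma psum_abelian_closure x lo y : weight_bound x lo ->
  (forall i j : nat, lo (j%:Z - i%:Z) <= psum y j - psum y i) -> abelian_closure x y.
Proof.
move=> [xlo loP] ylo _ [i [n ->]].
have [a [a' [ea wa]]] := loP n%:Z; have [b [b' [eb wb]]] := loP (- n%:Z).
have {ea}ea : a' = (a + n)%N by lia.
have {eb}eb : b = (b' + n)%N by lia.
subst a' b.
pose f k := psum x (k + n)%N - psum x k.
have [k|||c fc] := @int_ivt f (psum y (i + n)%N - psum y i) a b'.
- by rewrite /f addSn !psumS; case: (x (k + n)%N); case: (x k); lia.
- by rewrite /f wa; have := ylo i (i + n)%N; rewrite PoszD addrAC subrr add0r.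
- by rewrite /f; have := ylo (i + n)%N i; rewrite (_ : _ - _ = - n%:Z) -?wb; lia.
exists (factor_at x c n); first exact: language_factor_at.
apply: abelian_equiv_bool; first by rewrite !size_factor_at.
suff : (count_mem true (factor_at y i n))%:Z = count_mem true (factor_at x c n) by case.
by rewrite !count_factor_at -fc.
Qed.

Definition word_of_psum (T : nat -> int) : infword bool := fun n => T n.+1 != T n.

Lemma psum_word_of_psum T n :
  (forall k, T k <= T k.+1 <= T k + 1) -> psum (word_of_psum T) n = T n - T 0.
Proof.
move=> TS; elim: n => [|n IH]; first by rewrite subrr /psum big_ord0.
by rewrite psumS IH /word_of_psum; have := TS n; case: eqP => /=; lia.
Qed.

(** * Balanced words *)

Section Balanced.
Variable x : infword bool.
Hypothesis ux : uniformly_recurrent x.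
Hypothesis ax : aperiodic x.

Let A n := [set u | language x u /\ size u = n].

(** If every factor of length [n] determined the next letter, the return of one factor would force
    periodicity. *)
Lemma right_special n : exists i j,
  factor_at x i n = factor_at x j n /\ x (i + n)%N <> x (j + n)%N.
Proof.
apply: contrapT => nrs.
have det i j : factor_at x i n = factor_at x j n -> x (i + n)%N = x (j + n)%N.
  by move=> e; apply: contrapT => ne; apply: nrs; exists i, j.
have [K HK] := (uniformly_recurrentP x).1 ux 0%N n.
(* Searching from 1 rather than 0 makes the period [1 + a] positive. *)
have [a _ ea] := HK 1%N.
have per t : factor_at x (1 + a + t) n = factor_at x t n.
  elim: t => [|t IH]; first by rewrite addn0.
  apply/eq_factor_at => k kn.
  have -> : (1 + a + t.+1 + k = 1 + a + t + k.+1)%N by lia.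
  have -> : (t.+1 + k = t + k.+1)%N by lia.
  have [kn'|] := ltnP k.+1 n; first by have /eq_factor_at := IH; apply.
  move=> nk; have {nk}<- : n = k.+1 by apply/eqP; rewrite eqn_leq kn nk.
  exact: det.
have [i ni] := aperiodicP n ax (ltn0Sn a); apply.
have := det _ _ (per (i - n)%N); rewrite subnK // => <-; congr x; lia.
Qed.

(** Every factor of length [n] extends to the right, and a right special one does so in two ways. *)
Lemma many_factors n : exists s : seq (seq bool),
  [/\ uniq s, size s = n.+1 & forall u, u \in s -> A n u].
Proof.
elim: n => [|n [s [us ss sA]]].
  exists [:: [::]]; split=> // u; rewrite inE => /eqP ->.
  by split=> //; exact: (language_factor_at x 0 0).
have ext u : exists v, language x u -> size u = n -> A n.+1 v /\ take n v = u.
  have [[i [m ->]]|nu] := pselect (language x u); last by exists u.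
  exists (factor_at x i m.+1) => _; rewrite size_factor_at => <-.
  split; first by split; [exact: language_factor_at|exact: size_factor_at].
  rewrite /factor_at mkseqS -cats1 take_size_cat //; exact: size_factor_at.
have [e eP] := choice ext.
have eA u : u \in s -> A n.+1 (e u) /\ take n (e u) = u.
  by move=> /sA [lu su]; exact: eP.
have [i [j [eij xij]]] := right_special n.
have [k [uk ek]] : exists k, factor_at x k n = factor_at x i n /\
    factor_at x k n.+1 <> e (factor_at x i n).
  have [ei|] := pselect (factor_at x i n.+1 = e (factor_at x i n)); last by exists i.
  exists j; split=> // ej; apply: xij.
  by have := ei; rewrite -ej => /eq_factor_at; apply.
have tk : take n (factor_at x k n.+1) = factor_at x k n.
  rewrite /factor_at mkseqS -cats1 take_size_cat //; exact: size_factor_at.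
exists (factor_at x k n.+1 :: map e s); split.
- rewrite /= map_inj_in_uniq ?us ?andbT.
    apply/negP => /mapP [u us' eu]; apply: ek; rewrite eu; congr e.
    by have [_ <-] := eA _ us'; rewrite -eu tk.
  by move=> u v /eA [_ {2}<-] /eA [_ {2}<-] ->.
- by rewrite /= size_map ss.
- move=> u; rewrite inE => /predU1P [->|/mapP [v /eA [vA _] ->] //].
  by split; [exact: language_factor_at|exact: size_factor_at].
Qed.

(* For a balanced word, the differences between the prefix weights of two factors
   of equal length lie in {-1, 0, 1} and have constant sign, so that the sum [phi]
   of the prefix weights identifies a factor, and takes at most [n.+1] values. *)
Lemma unbalanced : ~ sturmian x ->
  exists i j n, psum x (j + n)%N - psum x j + 2 <= psum x (i + n)%N - psum x i.
Proof.
move=> nst; apply: contrapT => nub; apply: nst => n.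
have bal i j m : psum x (i + m)%N - psum x i <= psum x (j + m)%N - psum x j + 1.
  by have [//|lt] := leP; case: nub; exists i, j, m; lia.
pose c i j k := psum x (i + k)%N - psum x i - (psum x (j + k)%N - psum x j).
have c1 i j k l : -1 <= c i j k - c i j l <= 1.
  rewrite /c; have [kl|/ltnW lk] := leqP k l.
    have := bal (i + k)%N (j + k)%N (l - k)%N; have := bal (j + k)%N (i + k)%N (l - k)%N.
    by rewrite -!addnA subnKC //; lia.
  have := bal (i + l)%N (j + l)%N (k - l)%N; have := bal (j + l)%N (i + l)%N (k - l)%N.
  by rewrite -!addnA subnKC //; lia.
have c0 i j : c i j 0%N = 0 by rewrite /c !addn0 !subrr.
pose phi (u : seq bool) := (\sum_(k < n.+1) count_mem true (take k u))%N.
have phiE i : (phi (factor_at x i n))%:Z = \sum_(k < n.+1) (psum x (i + k)%N - psum x i).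
  rewrite /phi (big_morph Posz PoszD (erefl _)); apply: eq_bigr => k _.
  rewrite -count_factor_at; congr (Posz (count_mem _ _)).
  by rewrite /factor_at /mkseq -map_take take_iota (minn_idPl _) // -ltnS.
have phiB i j : (phi (factor_at x i n))%:Z - (phi (factor_at x j n))%:Z =
    \sum_(k < n.+1) c i j k.
  by rewrite !phiE -sumrB.
have phi_inj i j : phi (factor_at x i n) = phi (factor_at x j n) ->
    factor_at x i n = factor_at x j n.
  (* If [c] is positive somewhere, it is nonnegative everywhere; as its sum is zero, it vanishes, a
     contradiction. *)
  have pos i' j' k : phi (factor_at x i' n) = phi (factor_at x j' n) ->
      (k <= n)%N -> c i' j' k <= 0.
    move=> e kn; rewrite leNgt; apply/negP => ck.
    have ge0 l : 0 <= c i' j' l by have := c1 i' j' l k; lia.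
    have := phiB i' j'; rewrite e subrr => /esym /psumr_eq0P.
    by move=> /(_ (fun l _ => ge0 l)) /(_ (Ordinal (kn : (k < n.+1)%N)) isT) /= ; lia.
  move=> e; apply/eq_psum_factor_at => t tn.
  by have := pos _ _ _ e tn; have := pos _ _ _ (esym e) tn; rewrite /c; lia.
have phi_le i j : (phi (factor_at x i n) <= phi (factor_at x j n) + n)%N.
  suff : \sum_(k < n.+1) c i j k <= n%:Z by rewrite -phiB; lia.
  rewrite big_ord_recl c0 add0r; apply: le_trans (_ : \sum_(k < n) 1%:Z <= _).
    by apply: ler_sum => k _; have := c1 i j (lift ord0 k) 0%N; rewrite c0; lia.
  by rewrite sumr_const card_ord; lia.
have [b [[ib bE] bmin]] : exists b, (exists i, phi (factor_at x i n) = b) /\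
    forall i, (b <= phi (factor_at x i n))%N.
  pose P b := `[< exists i, phi (factor_at x i n) = b >].
  have exP : exists b, P b by exists (phi (factor_at x 0 n)); apply/asboolP; exists 0%N.
  case: (ex_minnP exP) => b /asboolP bP bmin; exists b; split=> // i.
  by apply: bmin; apply/asboolP; exists i.
rewrite card_eq_le; apply/andP; split.
  have gi : {in A n &, injective (fun u => phi u - b)%N}.
    move=> u v /set_mem [[i [m ->]]]; rewrite size_factor_at => ->.
    move=> /set_mem [[j [m' ->]]]; rewrite size_factor_at => -> /= e.
    by apply: phi_inj; have := bmin i; have := bmin j; lia.
  rewrite -(card_le_eql (inj_card_eq gi)); apply: subset_card_le.
  move=> _ [_ [[i [m ->]]]] + <-; rewrite size_factor_at => -> /=.
  by have := phi_le i ib; rewrite bE; lia.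
have [s [us ss sA]] := many_factors n.
have gi : {in `I_n.+1 &, injective (nth [::] s)}.
  move=> i j /set_mem /= ilt /set_mem /= jlt /eqP.
  by rewrite nth_uniq ?ss // => /eqP.
rewrite -(card_le_eql (inj_card_eq gi)); apply: subset_card_le => _ [i /= ilt <-].
by apply: sA; rewrite mem_nth ?ss.
Qed.
End Balanced.

(** * Rational slope *)

Section RationalSlope.
Variables (x : infword bool) (lo : int -> int).
Hypothesis ux : uniformly_recurrent x.
Hypothesis ax : aperiodic x.
Hypothesis xlo : weight_bound x lo.

(* In case of equality, [F = +-(q S_i - p i)] never decreases along steps of length
   [n = |N|], and by recurrence it increases at bounded gaps. The sum [G] of [F]
   over [n] consecutive positions then has a positive drift, whereas the bounds
   [lo] are attained at arbitrarily large distances. *)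
Lemma slope_bound_strict (p q N : int) : 0 < q -> (forall K, q * lo K <= p * K) ->
  N != 0 -> q * lo N < p * N.
Proof.
move=> q0 sl N0; rewrite lt_neqAle sl andbT; apply/eqP => eqN.
have [loP loA] := xlo.
pose s : int := Num.sg N; pose n := `|N|%N.
have s1 : s = 1 \/ s = -1 by rewrite /s; case: sgrP N0 => //; [left|right].
have n0 : (0 < n)%N by rewrite /n; lia.
have sN : s * n%:Z = N by rewrite /s /n abszE -numEsg.
pose F i := s * (q * psum x i - p * i%:Z).
have Fle i : F i <= F (i + n)%N.
  rewrite -subr_ge0 /F; case: s1 sN => -> sN.
    have := loP i (i + n)%N; rewrite (_ : _ - i%:Z = N); last by lia.
    by nia.
  have := loP (i + n)%N i; rewrite (_ : _ - _ = N); last by lia.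
  by nia.
(* Otherwise [F] would be [n]-periodic, and its increments would make [x] periodic too. *)
have [i0 Fi0] : exists i0, F i0 + 1 <= F (i0 + n)%N.
  apply: contrapT => nF; have [i _] := aperiodicP 0 ax n0; apply.
  have Feq j : F (j + n)%N = F j.
    apply: le_anti; rewrite Fle andbT leNgt; apply/negP => lt.
    by apply: nF; exists j; lia.
  have := Feq i; have := Feq i.+1; rewrite /F addSn !psumS.
  by case: (x i); case: (x (i + n)%N) => //=; case: s1 => ->; nia.
have [K HK] := (uniformly_recurrentP x).1 ux i0 n.
have Finc j : exists2 a, (a <= K)%N & F (j + a)%N + 1 <= F (j + a + n)%N.
  have [a aK /eq_psum_factor_at e] := HK j; exists a => //.
  have := e n (leqnn n); move: Fi0; rewrite /F.
  by case: s1 => ->; nia.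
pose G i := \sum_(r < n) F (i + r)%N.
have GS i : G i.+1 = G i + (F (i + n)%N - F i).
  rewrite /G; case: (n) n0 => // m _.
  rewrite big_ord_recr big_ord_recl /= addn0.
  rewrite addrC addSnnS [RHS]addrC addrA subrK.
  by congr (_ + _); apply: eq_bigr => r _; rewrite addSnnS.
have Gle i d : G i <= G (i + d)%N.
  elim: d => [|d IH]; first by rewrite addn0.
  by rewrite addnS GS; have := Fle (i + d)%N; lia.
have Ginc i : G i + 1 <= G (i + K.+1)%N.
  have [a aK Fa] := Finc i.
  have := Gle (i + a).+1 (K - a)%N; rewrite GS; have := Gle i a.
  by rewrite (_ : ((i + a).+1 + (K - a) = i + K.+1)%N); lia.
have Gt i t : G i + t%:Z <= G (i + t * K.+1)%N.
  elim: t => [|t IH]; first by rewrite addn0 addr0.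
  by have := Ginc (i + t * K.+1)%N; rewrite -addnA -mulSnr; lia.
pose C : int := q + `|p|.
have Fstep i r : `|F (i + r)%N - F i| <= C * r%:Z.
  have := psum_leD x i r; rewrite /F /C.
  by case: s1 => ->; have [p0|p0] := leP 0 p; nia.
have Gup i M : F (i + M)%N <= F i -> G (i + M)%N <= G i + n%:Z * (2 * C * n%:Z).
  move=> FM; rewrite -lerBlDl /G -sumrB.
  have -> : n%:Z * (2 * C * n%:Z) = \sum_(r < n) (2 * C * n%:Z).
    by rewrite sumr_const card_ord -[RHS]mulr_natl (natz n).
  apply: ler_sum => r _; have := Fstep i r; have := Fstep (i + M)%N r.
    have := ltn_ord r; rewrite /C; nia.
(* [G] rises by at least [t] over the distance [M], whereas [Gup] allows only [t - 1]. *)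
pose t := (`|(n%:Z * (2 * C * n%:Z))%R|.+1)%N; pose M := (t * K.+1)%N.
have [i FM] : exists i, F (i + M)%N <= F i.
  have := sl (s * M%:Z); have [i [j [eij <-]]] := loA (s * M%:Z).
  case: s1 eij => es eij slM.
    exists i; rewrite /F es (_ : j = (i + M)%N) in slM *; first by nia.
    by move: eij; rewrite es; lia.
  exists j; rewrite /F es (_ : i = (j + M)%N) in slM *; first by nia.
  by move: eij; rewrite es; lia.
by have := Gt i t; have := Gup _ _ FM; rewrite -/M /t; lia.
Qed.
End RationalSlope.

(** * Periodic words close to a rational line *)

Lemma periodic_uniformly_recurrent (S : finType) (y : infword S) P : (0 < P)%N ->
  (forall n, y (n + P)%N = y n) -> uniformly_recurrent y.
Proof.
move=> P0 per; apply/uniformly_recurrentP => i n; exists (P + P)%N => j.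
have perk k m : y (m + k * P)%N = y m.
  by elim: k => [|k IH]; [rewrite addn0|rewrite mulSnr addnA per].
(* From [j] go up to the next multiple of [P], then on by [i] modulo [P]. *)
exists (i %% P + (P - j %% P))%N.
  by have := ltn_pmod i P0; lia.
apply/eq_factor_at => t _.
rewrite -[RHS](perk (j %/ P)%N.+1) -[LHS](perk (i %/ P)%N); congr y.
by have := divn_eq i P; have := divn_eq j P; have := ltn_pmod j P0; nia.
Qed.

Section RationalWords.
Variables (p q : nat).
Hypotheses (p0 : (0 < p)%N) (pq : (p < q)%N).

Definition dented_line k n : int := (n * p %/ q)%N%:Z - (k * q %| n)%N%:Z.

Lemma modn_mul_eq0 k m : (k * q %| m)%N -> (m * p %% q = 0)%N.
Proof.
by move=> km; apply/eqP; apply: dvdn_mulr; apply: dvdn_trans km; exact: dvdn_mull.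
Qed.

(** A dent at [n.+1] cancels a rise of the floor, since the remainder there is 0 and [p > 0]. The
    recovery from a dent at [n] falls on a step where the floor is constant, since [p < q]. *)
Lemma dented_lineS k n : (0 < k)%N ->
  dented_line k n <= dented_line k n.+1 <= dented_line k n + 1.
Proof.
move=> k0; rewrite /dented_line.
have q0 : (0 < q)%N by lia.
have := divn_eq (n * p) q; have := divn_eq (n.+1 * p) q.
have := ltn_pmod (n * p) q0; have := ltn_pmod (n.+1 * p) q0.
have := @modn_mul_eq0 k n; have := @modn_mul_eq0 k n.+1; rewrite mulSn.
set f := (_ %/ q)%N; set f' := ((p + n * p) %/ q)%N.
set r := (_ %% q)%N; set r' := ((p + n * p) %% q)%N.
case: (boolP (_ %| n.+1)%N) => [_ /(_ isT) rr'|_ _];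
  case: (boolP (_ %| n)%N) => [_ /(_ isT) rr|_ _] /= lr' lr e' e; nia.
Qed.

Lemma psum_dented k n : (0 < k)%N ->
  psum (word_of_psum (dented_line k)) n = dented_line k n + 1.
Proof.
move=> k0; rewrite psum_word_of_psum; last by move=> m; exact: dented_lineS.
by rewrite {2}/dented_line mul0n div0n dvdn0 /=; lia.
Qed.

Lemma dented_line_period k n : (0 < k)%N ->
  dented_line k (n + k * q)%N = dented_line k n + (k * p)%N%:Z.
Proof.
move=> k0; rewrite /dented_line dvdn_addl // mulnDl (mulnAC k) addnC divnMDl ?PoszD; lia.
Qed.

Lemma dented_uniformly_recurrent k :
  (0 < k)%N -> uniformly_recurrent (word_of_psum (dented_line k)).
Proof.
move=> k0; apply: (@periodic_uniformly_recurrent _ _ (k * q)).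
  by rewrite muln_gt0 k0; lia.
move=> n; rewrite /word_of_psum -addSn !dented_line_period //.
by rewrite (inj_eq (addIr _)).
Qed.

(** The first [k * q] letters of the word for [l] climb out of the dent at 0 and end at no dent, so
    they contain [k * p + 1] ones; every factor of this length of the word for [k] contains
    [k * p]. *)
Lemma dented_language k l : (0 < k)%N -> (k < l)%N ->
  language (word_of_psum (dented_line l)) <> language (word_of_psum (dented_line k)).
Proof.
move=> k0 kl e.
have := language_factor_at (word_of_psum (dented_line l)) 0 (k * q).
rewrite e => -[i [n en]].
have kqn : (k * q = n)%N by have := congr1 size en; rewrite !size_factor_at.
have := congr1 (fun u => Posz (count_mem true u)) en.
rewrite !count_factor_at -kqn add0n !psum_dented; try lia.
rewrite dented_line_period // /dented_line mul0n div0n dvdn0 gtnNdvd /=.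
- by rewrite mulnAC mulnK; lia.
- by rewrite muln_gt0 k0; lia.
- by rewrite ltn_mul2r kl; lia.
Qed.

(** At a dent [j], [q] divides [j * p], so the strict inequality puts [lo] at least one unit below
    the difference of the floors. *)
Lemma dented_weight lo k : (0 < k)%N -> lo 0 = 0 ->
    (forall N, N != 0 -> q%:Z * lo N < p%:Z * N) ->
  forall i j : nat, lo (j%:Z - i%:Z) <= dented_line k j - dented_line k i.
Proof.
move=> k0 lo0 lt i j.
have q0 : (0 < q)%N by lia.
have [->|ij] := eqVneq i j; first by rewrite !subrr lo0.
have := lt (j%:Z - i%:Z) _; rewrite subr_eq0 eq_sym (_ : (i%:Z == j) = false); last by lia.
move=> /(_ isT); rewrite /dented_line.
have := divn_eq (i * p) q; have := divn_eq (j * p) q.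
have := ltn_pmod (i * p) q0; have := ltn_pmod (j * p) q0.
have := @modn_mul_eq0 k j; have := @modn_mul_eq0 k i.
move: (i * p %/ q)%N (j * p %/ q)%N (i * p %% q)%N (j * p %% q)%N => f f' r r'.
move: (lo _) => L.
case: (_ %| i)%N; case: (_ %| j)%N => /= H H'; nia.
Qed.
End RationalWords.

(** * Irrational slope *)

Section IrrationalSlope.
Variables (R : realType) (alpha : R) (x : infword bool) (lo : int -> int).
Hypothesis ux : uniformly_recurrent x.
Hypothesis xlo : weight_bound x lo.
Hypothesis alpha_irr : forall N p : int, N != 0 -> alpha * N%:~R != p%:~R.

Definition excess (N : int) : R := alpha * N%:~R - (lo N)%:~R.

Hypothesis excess_sublinear : forall e, 0 < e ->
  exists C, forall N : int, excess N <= e * `|N|%:~R + C.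

Definition discrepancy (i : nat) : R := (psum x i)%:~R - alpha * i%:R.
Local Notation D := discrepancy.

Lemma discrepancyB i j :
  D j - D i = (psum x j - psum x i)%:~R - alpha * (j%:Z - i%:Z)%:~R.
Proof. by rewrite /D !rmorphB /= -!pmulrn; ring. Qed.

Lemma excess_ge i j : - excess (j%:Z - i%:Z) <= D j - D i.
Proof. by rewrite discrepancyB /excess opprB lerB // ler_int; exact: xlo.1. Qed.

(** Over equal distances the multiples of [alpha] cancel; a strict inequality between the remaining
    integers gains a whole unit. *)
Lemma discrepancy_lt a b c d : (a + d = c + b)%N ->
  (D a - D b < D c - D d) = (psum x a - psum x b < psum x c - psum x d).
Proof.
move=> e; rewrite !discrepancyB (_ : a%:Z - b%:Z = c%:Z - d%:Z); last by lia.
by rewrite ltrD2r ltr_int.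
Qed.

Lemma discrepancy_inj : injective D.
Proof.
move=> i j e; apply/eqP; apply: contraT => ij.
have /negP[] : alpha * (j%:Z - i%:Z)%:~R != (psum x j - psum x i)%:~R.
  by apply: alpha_irr; lia.
by apply/eqP; have := discrepancyB i j; rewrite e subrr => ?; lra.
Qed.

Lemma fractional_gap (L : nat) : exists2 eta : R, 0 < eta &
  forall k p : int, `|k| <= L%:Z -> 0 < alpha * k%:~R - p%:~R ->
    eta <= alpha * k%:~R - p%:~R.
Proof.
have gap1 (k : int) : exists2 eta : R, 0 < eta &
    forall p : int, 0 < alpha * k%:~R - p%:~R -> eta <= alpha * k%:~R - p%:~R.
  (* The subtracted integer is the greatest one strictly below [alpha * k]. *)
  exists (alpha * k%:~R - (Num.ceil (alpha * k%:~R) - 1)%:~R).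
    by rewrite subr_gt0 ceilB1_lt.
  move=> p; rewrite subr_gt0 -ceil_gt_int => pk.
  by rewrite lerB // ler_int; move: pk; move: (Num.ceil _) => c; lia.
elim: L => [|L [eta eta0 IH]].
  have [eta eta0 H] := gap1 0; exists eta => // k p k0.
  have -> : k = 0 by lia.
  exact: H.
have [eta1 eta10 H1] := gap1 L.+1%:Z; have [eta2 eta20 H2] := gap1 (- L.+1%:Z).
exists (Num.min eta (Num.min eta1 eta2)); first by rewrite !lt_min eta0 eta10.
move=> k p kL pk; rewrite !ge_min.
have [k1|[k1|k1]] : `|k| <= L%:Z \/ k = L.+1%:Z \/ k = - L.+1%:Z by lia.
- by rewrite IH.
- by rewrite k1 in pk *; rewrite H1 // orbT.
- by rewrite k1 in pk *; rewrite H2 // !orbT.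
Qed.

Lemma excess_local_max (L : nat) :
  exists N, forall k : int, `|k| <= L%:Z -> excess (N + k) <= excess N.
Proof.
apply: contrapT => nmax.
have [eta eta0 gap] := fractional_gap L.
have up N : exists2 k : int, `|k| <= L%:Z & excess N + eta <= excess (N + k).
  apply: contrapT => nk; apply: nmax; exists N => k kL.
  rewrite leNgt; apply/negP => lt; apply: nk; exists k => //.
  have E : excess (N + k) - excess N = alpha * k%:~R - (lo (N + k) - lo N)%:~R.
    by rewrite /excess !rmorphB rmorphD /=; ring.
  rewrite -lerBrDl E; apply: gap => //.
  by rewrite -E subr_gt0.
(* Climbing by [eta] at each step of length at most [L] contradicts sublinearity. *)
have chain (t : nat) : exists2 N : int, `|N| <= (t * L)%N%:Z &
    excess 0 + eta * t%:R <= excess N.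
  elim: t => [|t [N NL IH]]; first by exists 0; rewrite // mulr0 addr0.
  have [k kL Hk] := up N; exists (N + k); first by lia.
  by apply: le_trans Hk; rewrite -addn1 natrD; lra.
(* After [t] steps the distance is at most [t * L], so this [e] accounts for at most half of the
   climb [eta * t]; [t] is chosen so that the other half exceeds [C - excess 0]. *)
pose e := eta / (2 * L.+1%:R).
have L0 : 0 < L.+1%:R :> R by rewrite ltr0n.
have e0 : 0 < e by rewrite divr_gt0 // mulr_gt0.
have [C HC] := excess_sublinear e0.
pose t := (Num.trunc (`|C - excess 0| * 2 / eta)).+1.
have ht : `|C - excess 0| * 2 < eta * t%:R.
  by rewrite (mulrC eta) -ltr_pdivrMr //; exact: truncnS_gt.
have [N NL HN] := chain t.
have := HC N.
have eN : e * `|N|%:~R <= eta * t%:R / 2.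
  have -> : eta * t%:R / 2 = e * (t%:R * L.+1%:R).
    by rewrite /e; field; apply: lt0r_neq0; move: L0; rewrite -natr1; lra.
  rewrite ler_pM2l // -natrM pmulrn ler_int; lia.
have := ler_norm (C - excess 0); lra.
Qed.

(* [n] is the left end of the window, so the tested (central) position is [n + L]. *)
Definition raised (L n : nat) : bool :=
  [forall k : 'I_(L + L).+1, D (n + L) <= D (n + k)%N].

Definition raised_line (L n : nat) : int := psum x (n + L)%N + (raised L n)%:Z.

Lemma raisedP L n :
  reflect (forall k, (k <= L + L)%N -> D (n + L) <= D (n + k)) (raised L n).
Proof.
apply: (iffP forallP) => H k; last by apply: H; rewrite -ltnS.
by move=> kL; exact: (H (Ordinal (kL : (k < (L + L).+1)%N))).
Qed.

Lemma raisedPn L n : ~~ raised L n -> exists2 k, (k <= L + L)%N & D (n + k) < D (n + L).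
Proof.
by rewrite negb_forall => /existsP [k]; rewrite -ltNge; exists k; rewrite // -ltnS.
Qed.

(* If only [i] is raised, some [k] with [D (j + k) < D (j + L)] satisfies
   [D (i + L) <= D (i + k)]: translating the pair from [L] to [k] lowers the
   difference of prefix sums, which leaves room for the raise. *)
Lemma raised_line_weight L i j :
  lo (j%:Z - i%:Z) <= raised_line L j - raised_line L i.
Proof.
have shift k : lo (j%:Z - i%:Z) <= psum x (j + k)%N - psum x (i + k)%N.
  by rewrite (_ : j%:Z - i%:Z = (j + k)%N%:Z - (i + k)%N%:Z); [exact: xlo.1|lia].
have := shift L; rewrite /raised_line.
case: (boolP (raised L j)) => [rj|/raisedPn [k kL jk]]; first by case: raised; lia.
case: (boolP (raised L i)) => [/raisedP /(_ k kL) ik|_]; last by lia.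
have : D (j + k) - D (i + k) < D (j + L) - D (i + L) by lra.
by rewrite discrepancy_lt; [have := shift k; lia|lia].
Qed.

Lemma raised_lineS L n : raised_line L n <= raised_line L n.+1 <= raised_line L n + 1.
Proof.
have l1 : 0 <= lo 1.
  have [i [j [e <-]]] := xlo.2 1; have -> : j = (i + 1)%N by lia.
  by have := psum_leD x i 1; lia.
have l2 : -1 <= lo (-1).
  have [i [j [e <-]]] := xlo.2 (-1); have -> : i = (j + 1)%N by lia.
  by have := psum_leD x j 1; lia.
have := raised_line_weight L n n.+1; have := raised_line_weight L n.+1 n.
have -> : n%:Z - n.+1%:Z = -1 by lia.
have -> : n.+1%:Z - n%:Z = 1 by lia.
by lia.
Qed.

Definition raised_word L := word_of_psum (raised_line L).

Lemma psum_raised_word L n : psum (raised_word L) n = raised_line L n - raised_line L 0.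
Proof. by apply: psum_word_of_psum => k; exact: raised_lineS. Qed.

Lemma raised_word_abelian_closure L : abelian_closure x (raised_word L).
Proof.
apply: (psum_abelian_closure xlo) => i j; rewrite !psum_raised_word.
by have := raised_line_weight L i j; lia.
Qed.

Lemma raised_word_uniformly_recurrent L : uniformly_recurrent (raised_word L).
Proof.
apply/uniformly_recurrentP => i n.
(* The extra [L + L] letters cover the windows that decide which positions are raised. *)
have [K HK] := (uniformly_recurrentP x).1 ux i (n + (L + L))%N.
exists K => j; have [a aK /eq_psum_factor_at e] := HK j; exists a => //.
apply/eq_psum_factor_at => t tn; rewrite !psum_raised_word.
have eD s u : (s <= n + (L + L))%N -> (u <= n + (L + L))%N ->
    D (j + a + s) - D (j + a + u) = D (i + s) - D (i + u).
  move=> sn un; rewrite !discrepancyB; congr (_ - alpha * _).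
    by congr _%:~R; have := e s sn; have := e u un; lia.
  by congr _%:~R; lia.
have er s : (s <= n)%N -> raised L (j + a + s) = raised L (i + s).
  move=> sn; apply: eq_forallb => k; have := ltn_ord k => kL.
  rewrite -!addnA -subr_ge0 -[RHS]subr_ge0 !(addnA j) eD //; lia.
rewrite /raised_line er // -[(j + a)%N in X in _ - X]addn0 -[i in X in _ = _ - X]addn0.
have := e L _; have := e (t + L)%N _; have := er 0%N; rewrite !addn0 -!addnA => -> //.
by lia.
Qed.

Lemma raised_word_contains u : language x u ->
  exists L0, forall L, (L0 <= L)%N -> language (raised_word L) u.
Proof.
move=> [i [n ->]]; have [K HK] := (uniformly_recurrentP x).1 ux i n.
pose w := (K + n)%N; exists (w + w).+1 => L wL.
(* Two raised positions at most [L] apart see each other in their windows, so their discrepancies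
   agree, against irrationality. *)
have apart s s' : (s < s' <= L)%N -> raised L s -> raised L s' -> False.
  move=> /andP[ss sL] /raisedP rs /raisedP rs'.
  have : D (s + L) = D (s' + L).
    apply: le_anti; apply/andP; split.
      have := rs (s' - s + L)%N.
      rewrite (_ : (s + (s' - s + L) = s' + L)%N); last by lia.
      by apply; lia.
    have := rs' (L - (s' - s))%N; rewrite (_ : (s' + (L - (s' - s)) = s + L)%N); last by lia.
    by apply; lia.
  by move/discrepancy_inj; lia.
(* If some [t1 <= w] is raised, no other position up to [L] is, so the [w + 1] positions after [w]
   are free. *)
have [b nb] : exists b, forall t, (t <= w)%N -> ~~ raised L (b + t).
  have [|/existsNP [t1 /not_implyP [t1w /negP/negPn r1]]] :=
    pselect (forall t, (t <= w)%N -> ~~ raised L (0 + t)); first by exists 0%N.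
  exists w.+1 => t tw; apply/negP; apply: apart r1; lia.
have [a aK e] := HK (b + L)%N.
have line_b k : (k <= w)%N -> raised_line L (b + k) = psum x (b + L + k)%N.
  by move=> kw; rewrite /raised_line (negbTE (nb _ kw)) addr0 addnAC.
exists (b + a)%N, n; rewrite -e; apply/eq_psum_factor_at => t tn.
by rewrite !psum_raised_word -!addnA !line_b ?addnA; [ring| |]; rewrite /w; lia.
Qed.

Lemma raised_line_avoids (L i j : nat) :
    (0 < L)%N ->
    (forall n, exists a b, [/\ (a <= L)%N, (b <= L)%N & D (n + b) + 1 < D (n + a)]) ->
    (forall k : int, `|k| <= L%:Z ->
      excess (j%:Z - i%:Z + k) <= excess (j%:Z - i%:Z)) ->
  raised_line L j - raised_line L i <> lo (j%:Z - i%:Z).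
Proof.
move=> L0 osc mx; set N := j%:Z - i%:Z in mx *.
(* Moving one end of the pair within its window changes the distance by at most [L], so local
   maximality keeps [- excess N] as a lower bound. *)
have diffN (s t : nat) : (s <= L + L)%N -> (t = L \/ s = L) -> (t <= L + L)%N ->
    - excess N <= D (j + t) - D (i + s).
  move=> sL st tL; apply: le_trans (excess_ge _ _); rewrite lerN2.
  have -> : (j + t)%N%:Z - (i + s)%N%:Z = N + (t%:Z - s%:Z) by rewrite /N; lia.
  by apply: mx; lia.
have eqD : D (j + L) - D (i + L) =
    (psum x (j + L)%N - psum x (i + L)%N)%:~R - alpha * N%:~R.
  by rewrite discrepancyB; congr (_ - alpha * _%:~R); rewrite /N; lia.
have lower : lo N <= psum x (j + L)%N - psum x (i + L)%N.
  by have := xlo.1 (i + L)%N (j + L)%N; rewrite (_ : _ - _ = N) // /N; lia.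
rewrite /raised_line => e.
have [rij|[ri rj eN]] : raised L j = raised L i \/
    [/\ raised L i, raised L j = false & psum x (j + L)%N - psum x (i + L)%N = lo N + 1].
  move: e; case: (raised L j); case: (raised L i) => /= e; [by left|lia| |by left].
  by right; split=> //; lia.
  (* The pair realises [lo N] in [x]: then [j] is a local minimum, [i] a local maximum. *)
  have eN : psum x (j + L)%N - psum x (i + L)%N = lo N by rewrite -e rij; lia.
  have {}eqD : D (j + L) - D (i + L) = - excess N by rewrite eqD eN /excess opprB.
  have /raisedP rj : raised L j.
    apply/raisedP => k kL; have := diffN L k; rewrite leq_addr.
    by move=> /(_ isT (or_intror erefl) kL); lra.
  have /raisedP ri : raised L i by rewrite -rij; apply/raisedP.
  have k1 : (L.+1 <= L + L)%N by lia.
  have := ri _ k1; have := diffN L.+1 L k1 (or_introl erefl) (leq_addr _ _).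
  move=> h1 h2; have /discrepancy_inj : D (i + L) = D (i + L.+1) by lra.
  by lia.
(* Only [i] is raised: replacing [i] by a nearby [i + a] with [D] larger by more than
   one would go below the excess at [N]. *)
have [a [b [aL bL ab]]] := osc i.
have /raisedP /(_ b) := ri; rewrite (leq_trans bL) ?leq_addr // => /(_ isT) rb.
have := diffN a L _ (or_introl erefl) (leq_addr _ _); rewrite (leq_trans aL) ?leq_addr //.
move=> /(_ isT) da.
by move: eqD; rewrite eN rmorphD /= => eqD; move: da; rewrite /excess; lra.
Qed.

Hypothesis x_unbalanced :
  exists i j n, psum x (j + n)%N - psum x j + 2 <= psum x (i + n)%N - psum x i.

(** Two factors of equal length whose weights differ by at least 2 give increments of [D] that
    differ as much: one exceeds 1 or the other is at most -1, and irrationality excludes equality.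
    Recurrence brings such a pair into every long window. *)
Lemma discrepancy_oscillates : exists L0, forall L, (L0 <= L)%N ->
  forall n, exists a b, [/\ (a <= L)%N, (b <= L)%N & D (n + b) + 1 < D (n + a)].
Proof.
have [i [j [n unb]]] := x_unbalanced.
have [n0|n0] := posnP n; first by rewrite n0 !addn0 in unb; lia.
have far k : alpha * n%:Z%:~R != (psum x (k + n)%N - psum x k)%:~R + 1 /\
    alpha * n%:Z%:~R != (psum x (k + n)%N - psum x k)%:~R - 1.
  rewrite -[1]/(1%:~R) -!(rmorphD, rmorphB) /=.
  by split; apply: alpha_irr; lia.
have Dn k : D (k + n) - D k = (psum x (k + n)%N - psum x k)%:~R - alpha * n%:Z%:~R.
  by rewrite discrepancyB; congr (_ - alpha * _%:~R); lia.
have [c [[s t] [sn tn st]]] : exists c (st : nat * nat),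
    [/\ (st.1 <= n)%N, (st.2 <= n)%N & D (c + st.2) + 1 < D (c + st.1)].
  have [f1 f2] := far i; have [g1 g2] := far j.
  have : (psum x (j + n)%N - psum x j)%:~R + 2 <= (psum x (i + n)%N - psum x i)%:~R :> R.
    by rewrite -[2]/(2%:~R) -rmorphD ler_int.
  have := Dn i; have := Dn j => Dj Di uR.
  have [up|dn] := ltP 1 (D (i + n) - D i).
    by exists i, (n, 0%N); split=> //=; rewrite addn0; lra.
  exists j, (0%N, n); split=> //=; rewrite addn0.
  have : D (j + n) - D j <= -1 by lra.
  rewrite le_eqVlt => /predU1P [eq|]; last by lra.
  by case/eqP: g1; lra.
have [K HK] := (uniformly_recurrentP x).1 ux c n.
exists (K + n)%N => L KL m; have [a aK /eq_psum_factor_at e] := HK m.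
exists (a + s)%N, (a + t)%N; split; try by simpl in sn, tn; lia.
rewrite !addnA.
have : D (c + s) - D (c + t) = D (m + a + s) - D (m + a + t).
  rewrite !discrepancyB; congr (_%:~R - alpha * _%:~R); last by lia.
  by have := e s sn; have := e t tn; lia.
by move: st => /=; lra.
Qed.

Lemma raised_word_misses : exists L0, forall L, (L0 <= L)%N ->
  exists2 u, language x u & ~ language (raised_word L) u.
Proof.
have [L0 osc] := discrepancy_oscillates.
exists L0.+1 => L LL0; have [N Nmax] := excess_local_max L.
have L_gt0 : (0 < L)%N by lia.
have [i [j [ij eN]]] := xlo.2 N.
have avoid i' j' : j'%:Z - i'%:Z = N -> raised_line L j' - raised_line L i' <> lo N.
  move=> e; rewrite -e; apply: raised_line_avoids => //; last by rewrite e.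
  by apply: osc; lia.
have [ji|/ltnW ij'] := leqP i j.
  exists (factor_at x i (j - i)%N); first exact: language_factor_at.
  move=> [i' [n e]].
  have sn : (j - i = n)%N by have := congr1 size e; rewrite !size_factor_at.
  have := congr1 (fun v => Posz (count_mem true v)) e.
  rewrite !count_factor_at -sn subnKC // !psum_raised_word => ec.
  by apply: (avoid i' (i' + (j - i))%N); lia.
(* For negative [N], the missing factor is a heaviest one of length [- N]. *)
exists (factor_at x j (i - j)%N); first exact: language_factor_at.
move=> [i' [n e]].
have sn : (i - j = n)%N by have := congr1 size e; rewrite !size_factor_at.
have := congr1 (fun v => Posz (count_mem true v)) e.
rewrite !count_factor_at -sn subnKC // !psum_raised_word => ec.
by apply: (avoid (i' + (i - j))%N i'); lia.
Qed.
End IrrationalSlope.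

(** * Existence of an irrational slope *)

Section Slope.
Variables (x : infword bool) (lo : int -> int).
Hypothesis xlo : weight_bound x lo.

Lemma weight_bound0 : lo 0 = 0.
Proof.
have [i [j [e <-]]] := xlo.2 0; have -> : i = j by lia.
exact: subrr.
Qed.

Lemma weight_boundN N : lo N + lo (- N) <= 0.
Proof.
have [i [j [e <-]]] := xlo.2 N; have := xlo.1 j i.
have -> : i%:Z - j%:Z = - N by lia.
by lia.
Qed.

(** A pair realising the right-hand side is split at an intermediate point; the sign [s] treats
    lightest and heaviest factors at once. *)
Lemma weight_bound_superadditive (s : int) (a b : nat) : `|s| = 1 ->
  lo (s * a%:Z) + lo (s * b%:Z) <= lo (s * (a + b)%N%:Z).
Proof.
move=> s1; have [i [j [e <-]]] := xlo.2 (s * (a + b)%N%:Z).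
have [c ec] : exists c : nat, c%:Z = i%:Z + s * a%:Z.
  exists (`|(i%:Z + s * a%:Z)%R|)%N.
  have [es|es] : s = 1 \/ s = -1 by lia.
    by rewrite es in e *; lia.
  by rewrite es in e *; lia.
have := xlo.1 i c; have := xlo.1 c j.
have -> : c%:Z - i%:Z = s * a%:Z by lia.
have -> : j%:Z - c%:Z = s * b%:Z by rewrite PoszD mulrDr in e; lia.
by lia.
Qed.

Lemma weight_bound_mul (s : int) (k a : nat) : `|s| = 1 ->
  k%:Z * lo (s * a%:Z) <= lo (s * (k * a)%N%:Z).
Proof.
move=> s1; elim: k => [|k IH]; first by rewrite mul0r mul0n mulr0 weight_bound0.
by have := weight_bound_superadditive a (k * a) s1; rewrite -mulSn; nia.
Qed.

Lemma weight_bound_ge (N : int) : - `|N| <= lo N.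
Proof.
have [i [j [e <-]]] := xlo.2 N; have [ij|/ltnW ji] := leqP i j.
  by have := psum_leD x i (j - i); rewrite subnKC //; lia.
by have := psum_leD x j (i - j); rewrite subnKC //; lia.
Qed.

(** Both sides are compared with the extreme weights in the common length [n * k]. *)
Lemma weight_bound_slope_le (k n : nat) : n%:Z * lo k%:Z <= - (k%:Z * lo (- n%:Z)).
Proof.
have := @weight_bound_mul 1 n k erefl; have := @weight_bound_mul (-1) k n erefl.
rewrite !mul1r !mulN1r (mulnC k); have := weight_boundN (n * k)%N%:Z; lra.
Qed.

(** As in Fekete's lemma, divide [m] by [n]: the quotient contributes slope [e], the remainder a
    bounded amount. *)
Lemma subadditive_sublinear (R : realType) (g : nat -> R) (B e : R) n : 0 <= e ->
    (forall a b, g (a + b)%N <= g a + g b) -> (forall a, g a <= B * a%:R) ->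
    (0 < n)%N -> g n <= e * n%:R ->
  forall m, g m <= e * m%:R + `|B| * n%:R.
Proof.
move=> e0 gD gB n0 gn m; rewrite {1}(divn_eq m n).
have gk k r : g (k * n + r)%N <= e * (k * n)%N%:R + g r.
  elim: k => [|k IH]; first by rewrite mulr0 add0r.
  rewrite mulSn -addnA; apply: le_trans (gD _ _) _.
  by rewrite natrD mulrDr -addrA lerD.
apply: le_trans (gk _ _) _; apply: lerD.
  by rewrite ler_wpM2l // ler_nat leq_trunc_div.
apply: le_trans (gB _) _.
apply: le_trans (_ : `|B| * (m %% n)%N%:R <= _).
  by rewrite ler_wpM2r // ler_norm.
by rewrite ler_wpM2l // ler_nat ltnW // ltn_pmod.
Qed.

(** Take for [alpha] the supremum of the least densities [lo n / n]; were it rational, it would be a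
    slope excluded by the hypothesis. *)
Lemma irrational_slope_exists (R : realType) :
    (forall p q : int, 0 < q -> ~ (forall K, q * lo K <= p * K)) ->
  exists alpha : R, (forall N p : int, N != 0 -> alpha * N%:~R != p%:~R) /\
    (forall e, 0 < e -> exists C, forall N : int,
      excess alpha lo N <= e * `|N|%:~R + C).
Proof.
move=> nrat.
pose E := [set r : R | exists2 n : nat, (0 < n)%N & r = (lo n%:Z)%:~R / n%:R].
have ubE (n : nat) : (0 < n)%N -> ubound E (- (lo (- n%:Z))%:~R / n%:R).
  move=> n0 _ [k k0 ->].
  rewrite ler_pdivrMr ?ltr0n // mulrAC ler_pdivlMr ?ltr0n //.
  rewrite !pmulrn -[- _%:~R]rmorphN -!rmorphM ler_int.
  by have := weight_bound_slope_le k n; lia.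
have E0 : E !=set0 by exists ((lo 1%:Z)%:~R / 1%:R), 1%N.
have supE : has_sup E by split=> //; exists (- (lo (- 1%:Z))%:~R / 1%:R); exact: ubE.
pose alpha := sup E; exists alpha.
have lopos (n : nat) : (lo n%:Z)%:~R <= alpha * n%:R :> R.
  have [->|n0] := posnP n; first by rewrite weight_bound0 mulr0.
  rewrite -ler_pdivrMr ?ltr0n //; apply: sup_upper_bound => //; by exists n.
have loneg (n : nat) : (lo (- n%:Z))%:~R <= - (alpha * n%:R) :> R.
  have [->|n0] := posnP n; first by rewrite oppr0 weight_bound0 mulr0 oppr0.
  rewrite lerNr -ler_pdivlMr ?ltr0n //; apply: sup_le_ub => //; exact: ubE.
have above (p q : int) (n : nat) : 0 < q -> alpha * q%:~R <= p%:~R ->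
    q * lo n%:Z <= p * n%:Z.
  move=> q0 ap; rewrite -(ler_int R) !rmorphM /=.
  have q0' : 0 <= q%:~R :> R by rewrite ler0z ltW.
  have := ler_wpM2l q0' (lopos n); have := ler_wpM2r (ler0n R n) ap.
  by rewrite -pmulrn; lra.
split=> [N p N0|e e0].
  have irr (M r : int) : 0 < M -> alpha * M%:~R = r%:~R -> False.
    move=> M0 eM; apply: (nrat r M M0) => K.
    have [K0|K0] := leP 0 K.
      by have := @above r M `|K|%N M0; rewrite eM lexx gez0_abs //; apply.
    have M0' : 0 <= M%:~R :> R by rewrite ler0z ltW.
    have := ler_wpM2l M0' (loneg `|K|%N); rewrite -(ler_int R) !rmorphM /= -eM.
    rewrite ltz0_abs // opprK; have -> : `|K|%N%:R = - K%:~R :> R.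
      by rewrite pmulrn ltz0_abs // rmorphN.
    by lra.
  apply/eqP => eN; have [|Nneg|/eqP] := ltrgtP N 0; last by rewrite (negbTE N0).
    by move=> Nneg; apply: (@irr (- N) (- p)); [lia|rewrite !rmorphN mulrN eN].
  exact: (@irr N p).
have [nP nP0 hP] : exists2 n : nat, (0 < n)%N & alpha * n%:R - (lo n%:Z)%:~R <= e * n%:R.
  have [_ [n n0 ->] lt] := sup_adherent e0 supE.
  by exists n => //; move: lt; rewrite ltr_pdivlMr ?ltr0n // -/alpha; lra.
(* If all greatest densities exceeded [alpha + e], a rational between [alpha] and [alpha + e] would
   be an excluded slope. *)
have [nN nN0 hN] : exists2 n : nat, (0 < n)%N &
    - (alpha * n%:R) - (lo (- n%:Z))%:~R <= e * n%:R.
  apply: contrapT => none.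
  have [r] : exists r : rat, ratr r \in `]alpha, alpha + e[.
    by apply: rat_in_itvoo; rewrite ltrDl.
  rewrite in_itv /= => /andP[ar re].
  have q0 := denq_gt0 r.
  have q0' : 0 < (denq r)%:~R :> R by rewrite ltr0z.
  have er : ratr r * (denq r)%:~R = (numq r)%:~R :> R.
    by rewrite /ratr divfK // gt_eqF.
  apply: (nrat (numq r) (denq r) q0) => K.
  have [K0|K0] := leP 0 K.
    have := @above (numq r) (denq r) `|K|%N q0; rewrite gez0_abs //; apply.
    by rewrite -er ler_pM2r // ltW.
  have hK : (lo K)%:~R < (alpha + e) * K%:~R.
    have -> : K = - `|K|%N%:Z by lia.
    rewrite ltNge; apply/negP => le; apply: none; exists `|K|%N; first by lia.
    by move: le; rewrite rmorphN /= -pmulrn; lra.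
  rewrite -(ler_int R) !rmorphM /= -er.
  have K0' : K%:~R < 0 :> R by rewrite ltrz0.
  have h2 : (alpha + e) * K%:~R < ratr r * K%:~R by rewrite ltr_nM2r.
  have := ler_wpM2l (ltW q0') (ltW (lt_trans hK h2)); lra.
have e1 := ltW e0.
have mono (s : int) : `|s| = 1 -> forall a b : nat, excess alpha lo (s * (a + b)%N%:Z) <=
    excess alpha lo (s * a%:Z) + excess alpha lo (s * b%:Z).
  move=> s1 a b; have := weight_bound_superadditive a b s1.
  by rewrite -(ler_int R) /excess PoszD mulrDr !rmorphD /=; lra.
have bnd (s : int) : `|s| = 1 -> forall a : nat,
    excess alpha lo (s * a%:Z) <= (`|alpha| + 1) * a%:R.
  move=> s1 a; have := weight_bound_ge (s * a%:Z).
  rewrite normrM s1 mul1r -(ler_int R) rmorphN /=.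
  rewrite /excess rmorphM /= -!pmulrn => lb.
  have : alpha * (s%:~R * a%:R) <= `|alpha| * a%:R.
    rewrite mulrA ler_wpM2r //; apply: le_trans (ler_norm _) _.
    by rewrite normrM -intr_norm s1 mulr1.
  by lra.
have hP1 : excess alpha lo (1 * nP%:Z) <= e * nP%:R.
  by rewrite mul1r /excess -pmulrn.
have hN1 : excess alpha lo (-1 * nN%:Z) <= e * nN%:R.
  by rewrite mulN1r /excess rmorphN /= -pmulrn mulrN.
have subP := subadditive_sublinear e1 (mono 1 erefl) (bnd 1 erefl) nP0 hP1.
have subN := subadditive_sublinear e1 (mono (-1) erefl) (bnd (-1) erefl) nN0 hN1.
exists (`| `|alpha| + 1| * nP%:R + `| `|alpha| + 1| * nN%:R) => N.
have b1 : 0 <= `| `|alpha| + 1| * nP%:R by rewrite mulr_ge0.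
have b2 : 0 <= `| `|alpha| + 1| * nN%:R by rewrite mulr_ge0.
have [N0|N0] := leP 0 N.
  have := subP `|N|%N; rewrite mul1r (pmulrn _ `|N|%N) gez0_abs // (ger0_norm N0).
  by lra.
have := subN `|N|%N; rewrite mulN1r (pmulrn _ `|N|%N) ltz0_abs // opprK (ltr0_norm N0).
by lra.
Qed.
End Slope.

Theorem theorem2p6 (x : infword bool) :
  aperiodic x -> uniformly_recurrent x -> ~ sturmian x ->
  infinite_set [set X : set (infword bool) |
                  minimal_subshift X /\ X `<=` abelian_closure x].
Proof.
move=> ax ux nst; have [lo xlo] := weight_bound_exists x.
have [[p [q [q0 sl]]]|nrat] :=
    pselect (exists p q : int, 0 < q /\ forall K, q * lo K <= p * K).
  have lt N := @slope_bound_strict x lo ux ax xlo p q N q0 sl.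
  (* Strictness at 1 and -1 gives [0 < p < q], since a letter weighs 0 or 1. *)
  have p0 : 0 < p.
    have [i [j [e lo1]]] := xlo.2 1; have := lt 1 isT; rewrite -lo1.
    by have := psum_leD x i 1; rewrite (_ : (i + 1)%N = j); [nia|lia].
  have pq : p < q.
    have [i [j [e lo1]]] := xlo.2 (-1); have := lt (-1) isT; rewrite -lo1.
    by have := psum_leD x j 1; rewrite (_ : (j + 1)%N = i); [nia|lia].
  case: p q p0 pq q0 {sl} lt => // p [] // q p0 pq _ lt.
  apply: (@infinite_minimal_subshifts _ x (fun k => word_of_psum (dented_line p q k.+1))).
  - by move=> k; exact: dented_uniformly_recurrent.
  - move=> k; apply: (psum_abelian_closure xlo) => i j.
    rewrite !psum_dented // opprD addrACA subrr addr0.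
    by apply: dented_weight => //; exact: weight_bound0 xlo.
  - by move=> k; exists k.+1 => n kn; apply: dented_language.
have [|alpha [irr sub]] := @irrational_slope_exists x lo xlo Rdefinitions.R.
  by move=> p q q0 sl; apply: nrat; exists p, q.
have unb := unbalanced ux ax nst.
have [L0 miss] := raised_word_misses ux xlo irr sub unb.
apply: (@infinite_minimal_subshifts _ x (fun k => raised_word alpha x (L0 + k))).
- by move=> k; exact: raised_word_uniformly_recurrent ux xlo _.
- by move=> k; exact: (@raised_word_abelian_closure _ alpha x lo xlo).
- move=> k; have [u xu nu] := miss (L0 + k)%N (leq_addr _ _).
  have [L1 cont] := raised_word_contains ux xlo irr xu.
  exists L1 => n nL e; apply: nu; rewrite -e; apply: cont; lia.
Qed.
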